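(* Let $k\geq 0$ and $n\geq k$ be integers, and let $G$ be a $k$-degenerate graph of order $n$. Then $q(G)<q(S_{n,k})$, unless $G=S_{n,k}$.
   Context: All graphs are finite and simple. A graph $G$ is $k$-degenerate if every subgraph of $G$ contains a vertex of degree at most $k$. $S_{n,k}$ denotes the join of a complete graph of order $k$ and an independent set of order $n-k$. For a graph $H$, $q(H)$ denotes the largest eigenvalue of the signless Laplacian $Q(H)=D(H)+A(H)$, where $A(H)$ is the adjacency matrix and $D(H)$ the diagonal matrix of vertex degrees. *)

(* Defs.v *)
From mathcomp Require Import all_boot all_order all_algebra all_fingroup.
From mathcomp Require Import reals.
Set Implicit Arguments. Unset Strict Implicit. Unset Printing Implicit Defensive.
Import Order.TTheory GRing.Theory Num.Theory.
Local Open Scope ring_scope.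

Definition simple_graph (n : nat) (g : rel 'I_n) : Prop :=
  (forall x y, g x y = g y x) /\ (forall x, ~~ g x x).

Definition deg_in (n : nat) (g : rel 'I_n) (A : {set 'I_n}) (v : 'I_n) : nat :=
  #|[set u in A | g v u]|.

(* k-degenerate: every (nonempty) subgraph H -- vertex set A, edge relation h
   a symmetric subrelation of g restricted to A -- has a vertex of degree <= k. *)
Definition k_degenerate (n k : nat) (g : rel 'I_n) : Prop :=
  forall (A : {set 'I_n}) (h : rel 'I_n),
    A != set0 ->
    (forall x y, h x y = h y x) ->
    (forall x y, x \in A -> y \in A -> h x y -> g x y) ->
    exists2 v, v \in A & (deg_in h A v <= k)%N.

(* S_{n,k}: join of K_k (vertices 0..k-1) and an independent set (k..n-1). *)
Definition S_graph (n k : nat) : rel 'I_n :=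
  fun x y => (x != y) && ((x < k)%N || (y < k)%N).

Definition isomorphic (n : nat) (g h : rel 'I_n) : Prop :=
  exists f : {perm 'I_n}, forall x y, g x y = h (f x) (f y).

Definition signless_laplacian (R : realType) (n : nat) (g : rel 'I_n) : 'M[R]_n :=
  \matrix_(i, j) (if i == j then (#|[set u | g i u]|)%:R else (g i j)%:R).

Definition largest_eigenvalue (R : realType) (n : nat) (M : 'M[R]_n) (l : R) : Prop :=
  eigenvalue M l /\ (forall m, eigenvalue M m -> m <= l).

(* Main.v *)
Require Import Defs.
From mathcomp Require Import all_boot all_order all_algebra all_fingroup.
From mathcomp Require Import reals.
From mathcomp Require Import zify ring lra.
Set Implicit Arguments. Unset Strict Implicit. Unset Printing Implicit Defensive.
Import Order.TTheory GRing.Theory Num.Theory.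
Local Open Scope ring_scope.

(** Let [x] be the entrywise absolute value of an eigenvector of Q(G) for q(G),
    with the vertices relabelled so that [x] is nonincreasing, and let [D] be
    the adjacency matrix of S_{n,k} minus that of G.  Degeneracy bounds the
    number of edges inside every vertex set, and it follows that every
    upper-left corner of [D] has nonnegative sum.  Since x^T Q x is the sum of
    A_ij (x_i^2 + x_i x_j), summing by parts in both indices gives
    x^T Q(G) x <= x^T Q(S_{n,k}) x.  An explicit positive eigenvector [y] of
    S_{n,k} bounds the latter by q(S_{n,k}) |x|^2.  In the equality case [x] is
    a multiple of [y], which takes one value on the clique and one outside, so
    the corner sums of [D] vanish and G = S_{n,k}. *)

(** * Summation by parts against nonincreasing weights *)

Section AbelSummation.
Variable R : realType.

Lemma Abel_sum_ge0 (c z : nat -> R) n :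
  (forall m, (m <= n)%N -> 0 <= \sum_(i < m) c i) ->
  (forall i, z i.+1 <= z i) -> (forall i, 0 <= z i) ->
  0 <= \sum_(i < n) c i * z i.
Proof.
move=> c0 zS z0.
(* Strengthened for the induction: replacing [z n.+1] by [z n] only raises the left side, the full
   sum of [c] being nonnegative, and then the last terms cancel. *)
suff: z n * \sum_(i < n) c i <= \sum_(i < n) c i * z i.
  by apply: le_trans; rewrite mulr_ge0 ?c0.
elim: n c0 => [|n IHn] c0; first by rewrite !big_ord0 mulr0.
apply: (@le_trans _ _ (z n * \sum_(i < n.+1) c i)).
  by rewrite ler_wpM2r ?zS ?c0.
rewrite !big_ord_recr /= mulrDr [c n * _]mulrC lerD2r.
by apply: IHn => m lemn; apply: c0; apply: leqW.
Qed.

Lemma Abel_sum_ord_ge0 n (c z : 'I_n -> R) :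
  (forall m, (m <= n)%N -> 0 <= \sum_(i < n | (i < m)%N) c i) ->
  (forall i j : 'I_n, (i <= j)%N -> z j <= z i) -> (forall i, 0 <= z i) ->
  0 <= \sum_i c i * z i.
Proof.
move=> c0 z_anti z0.
(* Extending by 0 past [n] keeps [z] nonincreasing because [z] is nonnegative. *)
pose ext (f : 'I_n -> R) (i : nat) := oapp f 0 (insub i).
have extE f (i : 'I_n) : ext f i = f i by rewrite /ext valK.
under eq_bigr do rewrite -[c _]extE -[z _]extE.
apply: Abel_sum_ge0 => [m lemn | i | i].
- rewrite (big_ord_widen _ _ lemn).
  by under eq_bigr do rewrite extE; apply: c0.
- rewrite /ext; case: insubP => [j ltj vj|_] /=; last by case: insubP => //=.
  case: insubP => [l ltl vl|] /=; last by rewrite (ltnW ltj).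
  by apply: z_anti; rewrite vj vl.
- by rewrite /ext; case: insubP => //=.
Qed.

(** One index at a time: the weighted row sums [\sum_j D i j * z j] have nonnegative partial sums
    over [i], by a second summation by parts over [j]. *)
Lemma Abel_sum2_ge0 n (D : 'I_n -> 'I_n -> R) (y z : 'I_n -> R) :
  (forall s t, (s <= n)%N -> (t <= n)%N ->
     0 <= \sum_(i < n | (i < s)%N) \sum_(j < n | (j < t)%N) D i j) ->
  (forall i j : 'I_n, (i <= j)%N -> y j <= y i) -> (forall i, 0 <= y i) ->
  (forall i j : 'I_n, (i <= j)%N -> z j <= z i) -> (forall i, 0 <= z i) ->
  0 <= \sum_i \sum_j D i j * (y i * z j).
Proof.
move=> D0 y_anti y0 z_anti z0.
have -> : \sum_i \sum_j D i j * (y i * z j) = \sum_i (\sum_j D i j * z j) * y i.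
  by apply: eq_bigr => i _; rewrite mulr_suml; apply: eq_bigr => j _; ring.
apply: Abel_sum_ord_ge0 => // s les.
rewrite exchange_big /=; under eq_bigr do rewrite -mulr_suml.
apply: Abel_sum_ord_ge0 => // t tn.
by rewrite exchange_big; apply: D0.
Qed.

End AbelSummation.

Lemma antitone_perm (R : realType) n (x : 'I_n -> R) :
  exists f : {perm 'I_n}, forall i j : 'I_n, (i <= j)%N -> x (f j) <= x (f i).
Proof.
case: n x => [|n] x; first by exists 1%g => [[]].
pose le_x := fun i j => x j <= x i.
pose s := sort le_x (enum 'I_n.+1).
have size_s : size s = n.+1 by rewrite size_sort size_enum_ord.
have nth_inj : injective (fun i : 'I_n.+1 => nth ord0 s i).
  move=> i j /eqP; rewrite nth_uniq ?size_s ?sort_uniq ?enum_uniq //.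
  by move/eqP/val_inj.
exists (perm nth_inj) => i j leij; rewrite !permE.
have le_trans_x : transitive le_x by move=> a b c ba ac; apply: le_trans ba.
apply: (@sorted_leq_nth _ le_x le_trans_x) => //; rewrite ?inE ?size_s //.
- by move=> a; apply: lexx.
- by apply: sort_sorted => a b; apply: le_total.
Qed.

(** * Edge counts in degenerate graphs and in S_{n,k} *)

Section EdgeCounts.
Local Open Scope nat_scope.
Variable n : nat.
Implicit Types (g h : rel 'I_n) (A B : {set 'I_n}) (v : 'I_n).

(** Ordered pairs are counted, so in a simple graph each edge inside [A] contributes 2 to
    [arcs g A A]. *)
Definition arcs g A B : nat := \sum_(i in A) \sum_(j in B) g i j.

Lemma arcsC g A B : (forall i j, g i j = g j i) -> arcs g A B = arcs g B A.
Proof.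
move=> gC; rewrite /arcs exchange_big.
by apply: eq_bigr => i _; apply: eq_bigr => j _; rewrite gC.
Qed.

(** Reduces a rectangular corner to square ones; pairs between [A] and [B :\: A] occur twice on both
    sides. *)
Lemma arcs_subset g A B : (forall i j, g i j = g j i) -> A \subset B ->
  arcs g A B * 2 + arcs g (B :\: A) (B :\: A) = arcs g A A + arcs g B B.
Proof.
move=> gC /setIidPr AB.
have splitl C : arcs g B C = arcs g A C + arcs g (B :\: A) C.
  by rewrite /arcs (big_setID A) /= AB.
have splitr C : arcs g C B = arcs g C A + arcs g C (B :\: A).
  by rewrite arcsC // splitl; congr (_ + _); apply: arcsC.
rewrite (splitl B) !splitr (arcsC (B :\: A) A gC); lia.
Qed.

Lemma arcs_setU1 g A v : simple_graph g -> v \notin A ->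
  arcs g (v |: A) (v |: A) = (\sum_(j in A) g v j) * 2 + arcs g A A.
Proof.
move=> [gC gI] vA; rewrite /arcs big_setU1 //= big_setU1 //= (negbTE (gI v)).
rewrite add0n muln2 -addnn -addnA; congr (_ + _).
rewrite -big_split /=; apply: eq_bigr => i _.
by rewrite big_setU1 //= gC.
Qed.

Lemma deg_inE g A v : deg_in g A v = \sum_(j in A) g v j.
Proof.
rewrite /deg_in -sum1_card [RHS](eq_bigr (fun j => if g v j then 1 else 0)).
  by rewrite -big_mkcondr; apply: eq_bigl => j; rewrite inE.
by move=> j _; case: (g v j).
Qed.

Lemma sum_adj_le_card g A v : \sum_(j in A) g v j <= #|A|.
Proof. by rewrite -sum1_card; apply: leq_sum => j _; apply: leq_b1. Qed.

(** Deleting a vertex of degree at most [k] in the subgraph induced on [A] loses at most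
    [minn k (#|A| - 1)] edges; induction on [#|A|] does the rest. *)
Lemma arcs_degenerate g k A : simple_graph g -> k_degenerate k g ->
  arcs g A A <= (\sum_(j < #|A|) minn k j) * 2.
Proof.
move=> gS gk; move: {2}#|A| (erefl #|A|) => m.
elim: m A => [|m IHm] A Am.
  by move/eqP: Am; rewrite cards_eq0 => /eqP->; rewrite /arcs big_set0.
have A0 : A != set0 by rewrite -cards_eq0 Am.
have [//|//|v vA dv] := gk A g A0; first by case: gS.
have Am' : #|A :\ v| = m by move: (cardsD1 v A); rewrite vA Am add1n => -[].
rewrite -(setD1K vA) arcs_setU1 ?setD11 // setD1K //.
rewrite Am big_ord_recr /= mulnDl addnC leq_add //.
  by move: (IHm _ Am'); rewrite Am'.
rewrite leq_mul2r /= leq_min -Am' sum_adj_le_card andbT.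
by apply: leq_trans dv; rewrite deg_inE (big_setD1 v vA) leq_addl.
Qed.

Definition seg s : {set 'I_n} := [set i : 'I_n | i < s].

Lemma subset_seg s t : s <= t -> seg s \subset seg t.
Proof. by move=> st; apply/subsetP => i; rewrite !inE => /leq_trans->. Qed.

Lemma card_seg s : s <= n -> #|seg s| = s.
Proof.
move=> sn; rewrite -sum1_card (eq_bigl (fun i : 'I_n => i < s)).
  by rewrite -(big_ord_widen _ (fun=> 1) sn) sum1_card card_ord.
by move=> i; rewrite inE.
Qed.

Lemma simple_S_graph k : simple_graph (@S_graph n k).
Proof.
split=> [x y|x]; last by rewrite /S_graph eqxx.
by rewrite /S_graph eq_sym orbC.
Qed.

(** The bound of [arcs_degenerate] is attained here: vertex [j] has exactly [minn k j] earlier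
    neighbours. *)
Lemma arcs_S_graph_seg k s : s <= n ->
  arcs (@S_graph n k) (seg s) (seg s) = (\sum_(j < s) minn k j) * 2.
Proof.
elim: s => [|s IHs] sn.
  by rewrite big_ord0 /arcs big1 // => i; rewrite inE.
have [v vs] : exists v : 'I_n, v = s :> nat by exists (Ordinal sn).
have -> : seg s.+1 = v |: seg s.
  by apply/setP => i; rewrite !inE -val_eqE /= vs ltnS leq_eqVlt.
rewrite arcs_setU1; [|exact: simple_S_graph|by rewrite inE vs ltnn].
rewrite IHs 1?ltnW // big_ord_recr /= mulnDl addnC; congr (_ + _ * 2).
have -> : minn k s = #|seg (minn k s)| by rewrite card_seg // geq_min (ltnW sn) orbT.
rewrite -sum1_card [RHS]big_mkcond [LHS]big_mkcond /=.
apply: eq_bigr => j _; rewrite !inE /S_graph -val_eqE /= vs leq_min andbC.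
have [js | _] := ltnP j s; last by rewrite andbF.
rewrite neq_ltn js orbT !andbT.
by case: (ltnP s k) => [/(ltn_trans js)->|_] //=; case: (j < k).
Qed.

Lemma arcs_le g h A B : (forall i j, i \in A -> j \in B -> g i j -> h i j) ->
  arcs g A B <= arcs h A B.
Proof.
move=> gh; apply: leq_sum => i iA; apply: leq_sum => j jB.
by case: (g i j) (gh i j iA jB) => // ->.
Qed.

(* For [s <= k] every pair meeting [seg s] is an edge of S_{n,k}; for [k <= s]
   the vertices of [seg t] outside [seg s] are independent in S_{n,k}, so
   [arcs_subset] gives the count of S_{n,k} exactly and bounds that of [g]. *)
Lemma arcs_seg_le_S_graph g k s t : simple_graph g -> k_degenerate k g ->
  s <= n -> t <= n ->
  arcs g (seg s) (seg t) <= arcs (@S_graph n k) (seg s) (seg t).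
Proof.
move=> gS gk; have [gC gI] := gS; have [SC _] := simple_S_graph k.
wlog st : s t / s <= t => [IH|] sn tn.
  case/orP: (leq_total s t) => [/IH|/IH ts]; first exact.
  by rewrite arcsC // [leqRHS]arcsC // ts.
case: (leqP s k) => [sk | /ltnW ks].
  apply: arcs_le => i j; rewrite inE /S_graph => is_ _ gij.
  rewrite (leq_trans is_ sk) andbT; apply: contraTneq gij => ->; exact: gI.
have := arcs_subset gC (subset_seg st).
have := arcs_subset SC (subset_seg st).
have -> : arcs (@S_graph n k) (seg t :\: seg s) (seg t :\: seg s) = 0.
  rewrite /arcs big1 // => i; rewrite !inE => ?.
  rewrite big1 // => j; rewrite !inE /S_graph; lia.
rewrite !arcs_S_graph_seg //.
have := arcs_degenerate (seg s) gS gk; have := arcs_degenerate (seg t) gS gk.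
rewrite !card_seg //; lia.
Qed.

End EdgeCounts.

Lemma k_degenerate_perm n k (g : rel 'I_n) (f : {perm 'I_n}) :
  k_degenerate k g -> k_degenerate k (fun i j => g (f i) (f j)).
Proof.
move=> gk A h A0 hC hg.
pose h' := fun x y => h (f^-1%g x) (f^-1%g y).
have [| |x y|v /imsetP[u uA ->] dv] := gk (f @: A) h'.
- by rewrite imset_eq0.
- by move=> x y; apply: hC.
- case/imsetP=> x' x'A -> /imsetP[y' y'A ->]; rewrite /h' !permK.
  exact: hg.
exists u => //; move: dv; rewrite !deg_inE big_imset /=; last by move=> ? ? _ _ /perm_inj.
by rewrite /h' permK; under eq_bigr do rewrite permK.
Qed.

(** * The quadratic form of the signless Laplacian *)

Section QuadraticForm.
Variables (R : realType) (n : nat).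
Implicit Types (g : rel 'I_n) (x y : 'I_n -> R).

(** For simple [g] this is x^T Q(g) x, the degree term at [i] being spread over the neighbours of
    [i]. *)
Definition qform g x : R :=
  \sum_i \sum_j (g i j)%:R * (x i * (x i + x j)).

Lemma mul_signless_laplacian g (v : 'rV[R]_n) j : simple_graph g ->
  (v *m signless_laplacian R g) 0 j =
  \sum_i (g j i)%:R * (v 0 j + v 0 i).
Proof.
move=> [gC gI]; rewrite mxE (bigD1 j) //= mxE eqxx.
have -> : #|[set u | g j u]|%:R = \sum_(i | i != j) (g j i)%:R :> R.
  have := deg_inE g setT j; rewrite /deg_in.
  have -> : [set u in setT | g j u] = [set u | g j u].
    by apply/setP => u; rewrite !inE.
  move=> ->; rewrite natr_sum (eq_bigl predT); last by move=> i; rewrite inE.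
  by rewrite (bigD1 j) //= (negbTE (gI j)) add0r.
rewrite [RHS](bigD1 j) //= (negbTE (gI j)) mul0r add0r mulr_sumr -big_split /=.
apply: eq_bigr => i ij; rewrite mxE (negbTE ij) gC; ring.
Qed.

(** Taking absolute values in an eigenvector keeps the squares and can only raise the products
    [v 0 j * v 0 i]. *)
Lemma eigenvalue_le_qform g q : simple_graph g ->
  eigenvalue (signless_laplacian R g) q ->
  exists x, [/\ forall i, 0 <= x i, exists i, x i != 0 &
                q * \sum_i x i ^+ 2 <= qform g x].
Proof.
move=> gS /eigenvalueP[v vq v0]; exists (fun i => `|v 0 i|); split => //.
  apply/existsP; apply: contraNT v0 => /existsPn v0.
  apply/eqP/rowP => i; rewrite mxE.
  by apply/eqP; move: (v0 i); rewrite negbK normr_eq0.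
rewrite mulr_sumr; apply: ler_sum => j _.
have vj : q * v 0 j = \sum_i (g j i)%:R * (v 0 j + v 0 i).
  by rewrite -mul_signless_laplacian // vq mxE.
rewrite real_normK ?num_real // expr2 mulrA vj mulr_suml; apply: ler_sum => i _.
rewrite -mulrA ler_wpM2l ?ler0n // mulrDl mulrDr -!expr2 real_normK ?num_real //.
by rewrite lerD2l -normrM mulrC ler_norm.
Qed.

(* The spectral gap of [x] against a positive eigenvector [y], as a sum of
   squares. *)
Lemma qform_gap g lam x y : (forall i j, g i j = g j i) ->
  (forall i, 0 < y i) ->
  (forall i, \sum_j (g i j)%:R * (y i + y j) = lam * y i) ->
  (lam * \sum_i x i ^+ 2 - qform g x) *+ 2 =
  \sum_i \sum_j (g i j)%:R * ((x i * y j - x j * y i) ^+ 2 / (y i * y j)).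
Proof.
move=> gC y0 ylam.
pose F i j := (g i j)%:R * (x i ^+ 2 * y j / y i - x i * x j).
have gapE : lam * \sum_i x i ^+ 2 - qform g x = \sum_i \sum_j F i j.
  rewrite mulr_sumr -sumrB; apply: eq_bigr => i _.
  have -> : lam = (\sum_j (g i j)%:R * (y i + y j)) / y i.
    by rewrite ylam mulfK // gt_eqF.
  rewrite !mulr_suml -sumrB; apply: eq_bigr => j _; rewrite /F.
  by field; rewrite gt_eqF.
(* [F i j] alone need not be nonnegative; adding [F j i], by symmetry of [g], completes the square.
   Hence the factor 2. *)
rewrite mulr2n gapE {2}exchange_big -big_split /=; apply: eq_bigr => i _.
rewrite -big_split /=; apply: eq_bigr => j _; rewrite /F gC.
by field; rewrite !gt_eqF.
Qed.

Lemma qform_le g lam x y : (forall i j, g i j = g j i) ->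
  (forall i, 0 < y i) ->
  (forall i, \sum_j (g i j)%:R * (y i + y j) = lam * y i) ->
  qform g x <= lam * \sum_i x i ^+ 2.
Proof.
move=> gC y0 ylam; rewrite -subr_ge0 -(@pmulrn_lge0 _ _ 2) //.
rewrite (qform_gap _ gC y0 ylam); apply: sumr_ge0 => i _; apply: sumr_ge0 => j _.
by rewrite mulr_ge0 ?ler0n // divr_ge0 ?sqr_ge0 // mulr_ge0 // ltW.
Qed.

(** A zero gap kills every square in [qform_gap], so [x] and [y] are proportional along each
    edge. *)
Lemma qform_eq g lam x y : (forall i j, g i j = g j i) ->
  (forall i, 0 < y i) ->
  (forall i, \sum_j (g i j)%:R * (y i + y j) = lam * y i) ->
  qform g x = lam * \sum_i x i ^+ 2 ->
  forall i j, g i j -> x i * y j = x j * y i.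
Proof.
move=> gC y0 ylam xlam i j gij.
have F0 l m : 0 <= (g l m)%:R * ((x l * y m - x m * y l) ^+ 2 / (y l * y m)).
  by rewrite mulr_ge0 ?ler0n // divr_ge0 ?sqr_ge0 // mulr_ge0 // ltW.
have := qform_gap x gC y0 ylam; rewrite xlam subrr mul0rn => /esym/psumr_eq0P.
move/(_ (fun l _ => sumr_ge0 _ (fun m _ => F0 l m)) i isT)/psumr_eq0P.
move/(_ (fun m _ => F0 i m) j isT)/eqP.
rewrite gij mul1r mulf_eq0 sqrf_eq0 subr_eq0 invr_eq0 mulf_eq0.
by rewrite !(gt_eqF (y0 _)) !orbF => /eqP.
Qed.

(** * A positive eigenvector of S_{n,k} *)

Lemma sum_ltn_ord k : (k <= n)%N -> \sum_(i < n) (i < k)%N%:R = k%:R :> R.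
Proof.
move=> kn; rewrite -natr_sum; congr _%:R.
rewrite -{2}(card_seg kn) -sum1_card [RHS]big_mkcond /=.
by apply: eq_bigr => i _; rewrite inE; case: ltnP.
Qed.

(* The two equations say that the vector equal to [1 + d] on the clique and to
   [1] elsewhere is an eigenvector of S_{n,k} for [lam]. *)
Lemma S_graph_weights k : (0 < k <= n)%N ->
  exists d lam : R, [/\ 0 <= d, (k.+1 < n)%N -> 0 < d,
    (n%:R - 2) * (1 + d) + n%:R + d * k%:R = lam * (1 + d) &
    (k < n)%N -> k%:R * (2 + d) = lam].
Proof.
case/andP=> k0 kn.
have K0 : 1 <= k%:R :> R by rewrite ler1n.
case: (ltnP k.+1 n) => [kn1 | nk].
  have KN : k%:R + 2 <= n%:R :> R by rewrite -natrD ler_nat addn2.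
  set K := k%:R in K0 KN *; set N := n%:R in KN *.
  (* Eliminating [lam] leaves [K d^2 + B d - 2 (N - 1 - K) = 0]; [s ^+ 2] is its discriminant and
     the witness for [d] its positive root. *)
  pose B := 2 * K - N + 2; pose s := Num.sqrt (B ^+ 2 + 8 * K * (N - 1 - K)).
  have s0 : 0 <= s by apply: sqrtr_ge0.
  have s2 : s ^+ 2 = B ^+ 2 + 8 * K * (N - 1 - K).
    by rewrite sqr_sqrtr // addr_ge0 ?sqr_ge0 // mulr_ge0; lra.
  have Bs : B < s.
    rewrite ltNge; apply/negP => sB.
    have : 0 < K * (N - 1 - K) by rewrite mulr_gt0; lra.
    have : s ^+ 2 <= B ^+ 2 by rewrite ler_sqr ?nnegrE //; lra.
    lra.
  have d0 : 0 < (s - B) / (2 * K) by rewrite divr_gt0; lra.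
  exists ((s - B) / (2 * K)), (K * (2 + (s - B) / (2 * K))).
  split=> //; first exact: ltW.
  have sE : s = 2 * K * ((s - B) / (2 * K)) + B by field; lra.
  move: s2; rewrite {1}sE; move: ((s - B) / _) => d; rewrite /B => dE.
  have K4 : 4 * K != 0 by lra.
  by apply: (mulfI K4); lra.
(* Now [n] is [k] or [k.+1], so S_{n,k} is complete and the constant vector is an eigenvector. *)
exists 0, (2 * (n%:R - 1)); split=> //.
  by ring.
move=> kn1; have -> : n = k.+1 by apply/eqP; rewrite eqn_leq nk.
by rewrite -natr1; ring.
Qed.

Lemma S_graph_weights_eigen k (d lam : R) : (k <= n)%N ->
  (n%:R - 2) * (1 + d) + n%:R + d * k%:R = lam * (1 + d) ->
  ((k < n)%N -> k%:R * (2 + d) = lam) ->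
  let y (i : 'I_n) := 1 + d * (i < k)%N%:R in
  forall i, \sum_j (@S_graph n k i j)%:R * (y i + y j) = lam * y i.
Proof.
move=> kn clique indep y i; rewrite /y.
case: (ltnP i k) => [ik | ki] /=.
  rewrite mulr1 -clique.
  (* A clique vertex is adjacent to all vertices but itself: the full sum minus the diagonal
     term. *)
  transitivity (\sum_(j < n) (1 + d + (1 + d * (j < k)%N%:R))
                - (1 + d + (1 + d * (i < k)%N%:R))).
    rewrite [X in _ = X - _](bigD1 i) //= addrAC subrr add0r (bigD1 i) //=.
    rewrite /S_graph eqxx mul0r add0r; apply: eq_bigr => j ji.
    by rewrite eq_sym ji ik mul1r.
  rewrite ik !big_split /= -mulr_sumr sum_ltn_ord // !sumr_const card_ord.
  ring.
rewrite -indep ?(leq_ltn_trans ki) // mulr0 addr0 mulr1.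
rewrite -(sum_ltn_ord kn) mulr_suml; apply: eq_bigr => j _.
rewrite /S_graph ltnNge ki /=; case: ltnP => [jk | _]; last by rewrite andbF !mul0r.
have -> : i != j by rewrite -val_eqE /= gtn_eqF // (leq_trans jk).
by rewrite !mul1r mulr1; ring.
Qed.

End QuadraticForm.

Lemma psumr2_eq0P (R : numDomainType) (I J : finType) (P : pred I) (Q : pred J)
    (F : I -> J -> R) :
  (forall i j, P i -> Q j -> 0 <= F i j) ->
  \sum_(i | P i) \sum_(j | Q j) F i j = 0 ->
  forall i j, P i -> Q j -> F i j = 0.
Proof.
move=> F0 sum0 i j Pi Qj.
apply: (psumr_eq0P (fun j => F0 i j Pi)) Qj.
by apply: (psumr_eq0P _ sum0) => // l Pl; apply: sumr_ge0 => m; apply: F0.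
Qed.

(** * Comparison of the forms of [h] and S_{n,k} *)

Section Comparison.
Variables (R : realType) (n k : nat) (h : rel 'I_n).
Hypotheses (hS : simple_graph h) (hk : k_degenerate k h).

Let D (i j : 'I_n) : R := (@S_graph n k i j)%:R - (h i j)%:R.

Lemma sum_adj_diff_ge0 s t : (s <= n)%N -> (t <= n)%N ->
  0 <= \sum_(i < n | (i < s)%N) \sum_(j < n | (j < t)%N) D i j.
Proof.
have arcsE (e : rel 'I_n) : \sum_(i < n | (i < s)%N) \sum_(j < n | (j < t)%N)
    (e i j)%:R = (arcs e (seg n s) (seg n t))%:R :> R.
  rewrite natr_sum; apply: eq_big => [i|i _]; first by rewrite inE.
  by rewrite natr_sum; apply: eq_bigl => j; rewrite inE.
move=> sn tn; under eq_bigr do rewrite sumrB.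
by rewrite sumrB !arcsE subr_ge0 ler_nat arcs_seg_le_S_graph.
Qed.

Lemma qform_diffE (x : 'I_n -> R) :
  qform (@S_graph n k) x - qform h x =
  \sum_i \sum_j D i j * (x i * (x i + x j)).
Proof.
rewrite -sumrB; apply: eq_bigr => i _.
by rewrite -sumrB; apply: eq_bigr => j _; rewrite mulrBl.
Qed.

Lemma qform_le_S_graph (x : 'I_n -> R) : (forall i, 0 <= x i) ->
  (forall i j : 'I_n, (i <= j)%N -> x j <= x i) ->
  qform h x <= qform (@S_graph n k) x.
Proof.
move=> x0 x_anti; rewrite -subr_ge0 qform_diffE.
(* Each part of the weight becomes a nonincreasing factor in [i] times one in [j], as
   [Abel_sum2_ge0] requires. *)
have -> : \sum_i \sum_j D i j * (x i * (x i + x j)) =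
    \sum_i \sum_j D i j * (x i ^+ 2 * 1) + \sum_i \sum_j D i j * (x i * x j).
  rewrite -big_split; apply: eq_bigr => i _.
  by rewrite -big_split; apply: eq_bigr => j _ /=; ring.
apply: addr_ge0; apply: Abel_sum2_ge0 => //.
- exact: sum_adj_diff_ge0.
- by move=> i j ij; rewrite ler_sqr ?nnegrE ?x_anti.
- by move=> i; apply: sqr_ge0.
- exact: sum_adj_diff_ge0.
Qed.

Lemma qform_eq_S_graph (d c : R) (x : 'I_n -> R) : (k <= n)%N ->
  0 <= d -> ((k.+1 < n)%N -> 0 < d) -> c != 0 ->
  (forall i : 'I_n, x i = c * (1 + d * (i < k)%N%:R)) ->
  qform h x = qform (@S_graph n k) x -> h =2 @S_graph n k.
Proof.
move=> kn d0 dpos c0 xE hE.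
have [hC hI] := hS; have [SC SI] := simple_S_graph n k.
pose N s t := \sum_(i < n | (i < s)%N) \sum_(j < n | (j < t)%N) D i j.
have NE s t : N s t =
    \sum_(i < n) \sum_(j < n) D i j * ((i < s)%N%:R * (j < t)%N%:R).
  rewrite /N big_mkcond; apply: eq_bigr => i _ /=.
  case: (i < s)%N; last by rewrite big1 // => j _; rewrite mul0r mulr0.
  rewrite big_mkcond; apply: eq_bigr => j _ /=.
  by case: (j < t)%N; rewrite ?mulr0 ?mulr1.
have NC s : N s n = \sum_(i < n | (i < s)%N) \sum_j D i j.
  by apply: eq_bigr => i _; apply: eq_bigl => j; rewrite ltn_ord.
have Nnn : N n n = \sum_i \sum_j D i j.
  by rewrite NC; apply: eq_bigl => i; rewrite ltn_ord.
have N_ge0 s t : (s <= n)%N -> (t <= n)%N -> 0 <= N s t.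
  exact: sum_adj_diff_ge0.
(* With [a], [b] the indicators of [i < k], [j < k], the weight divided by [c ^+ 2] is [(1 + d a)(2
   + d a + d b) = 2 + (d^2 + 3 d) a + d b + d^2 a b], a combination of indicators of corners. *)
have sumN : 2 * N n n + (d ^+ 2 + 3 * d) * N k n + d * N n k + d ^+ 2 * N k k = 0.
  have c20 : c ^+ 2 != 0 by rewrite expf_neq0.
  apply: (mulfI c20); rewrite mulr0; apply/esym.
  rewrite -(subrr (qform h x)) {1}hE qform_diffE !NE !mulr_sumr -!big_split /=.
  rewrite mulr_sumr; apply: eq_bigr => i _.
  rewrite !mulr_sumr -!big_split /= mulr_sumr; apply: eq_bigr => j _.
  by rewrite !xE !ltn_ord; case: (i < k)%N; case: (j < k)%N => /=; ring.
have d20 : 0 <= d ^+ 2 by apply: sqr_ge0.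
have D1 := N_ge0 _ _ (leqnn n) (leqnn n).
have D2 : 0 <= (d ^+ 2 + 3 * d) * N k n by rewrite mulr_ge0 ?N_ge0 //; lra.
have D3 : 0 <= d * N n k by rewrite mulr_ge0 ?N_ge0.
have D4 : 0 <= d ^+ 2 * N k k by rewrite mulr_ge0 ?N_ge0.
have sumD0 : \sum_i \sum_j D i j = 0 by rewrite -Nnn; lra.
suff DE i j : D i j = 0.
  move=> i j; move/eqP: (DE i j); rewrite /D subr_eq0 eqr_nat.
  by case: (h i j); case: (@S_graph n k i j).
have D_ge0 l m : (l != m -> @S_graph n k l m) -> 0 <= D l m.
  rewrite /D subr_ge0 ler_nat; case: (eqVneq l m) => [-> _|_ -> //].
    by rewrite (negbTE (hI m)).
  by case: (h l m).
(* Clique rows of [D] are nonnegative with sum [N k n = 0], so they vanish, and the clique columns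
   by symmetry. Elsewhere S_{n,k} has no edges, so [D] is nonpositive with total 0. *)
case: (ltnP k.+1 n) => [/dpos d_gt0 | nk].
  have Nkn : N k n = 0.
    have : (d ^+ 2 + 3 * d) * N k n = 0 by lra.
    by move/eqP; rewrite mulf_eq0 gt_eqF /= => [/eqP|]; last lra.
  have Dk (l m : 'I_n) : (l < k)%N -> D l m = 0.
    move=> lk; rewrite NC in Nkn.
    apply: (psumr2_eq0P _ Nkn) => // l' m' l'k _.
    by apply: D_ge0 => lm; rewrite /S_graph lm l'k.
  have D_le0 l m : D l m <= 0.
    case: (ltnP l k) => [lk|kl]; first by rewrite Dk.
    case: (ltnP m k) => [mk|km]; first by rewrite /D SC hC -/(D m l) Dk.
    by rewrite /D /S_graph !ltnNge kl km andbF sub0r oppr_le0 ler0n.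
  apply/eqP; rewrite -oppr_eq0; apply/eqP.
  apply: (@psumr2_eq0P _ _ _ predT predT (fun l m => - D l m)) => //.
    by move=> l m _ _; rewrite oppr_ge0.
  by under eq_bigr do rewrite sumrN; rewrite sumrN sumD0 oppr0.
(* Here S_{n,k} is complete, so [D] is nonnegative everywhere. *)
apply: (psumr2_eq0P _ sumD0) => // l m _ _; apply: D_ge0 => lm.
rewrite /S_graph lm /=; move: lm (ltn_ord l) (ltn_ord m); rewrite -val_eqE /=.
lia.
Qed.

End Comparison.

Theorem theorem2 (R : realType) (k n : nat) (g : rel 'I_n) (qG qS : R) :
  (k <= n)%N ->
  simple_graph g ->
  k_degenerate k g ->
  largest_eigenvalue (signless_laplacian R g) qG ->
  largest_eigenvalue (signless_laplacian R (@S_graph n k)) qS ->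
  ~ isomorphic g (@S_graph n k) ->
  qG < qS.
Proof.
move=> kn gS gk [eG _] [_ maxS] niso; rewrite ltNge; apply/negP => qSG.
have SS := simple_S_graph n k; have [SC _] := SS.
(* For [k = 0] both graphs are edgeless, hence equal. *)
case: (posnP k) => [k0|k0].
  apply: niso; exists 1%g => x y; rewrite !perm1 /S_graph k0 andbF.
  have := arcs_degenerate setT gS gk; rewrite big1 => [|i _]; last by rewrite k0 min0n.
  rewrite leqn0 sum_nat_eq0 => /forallP/(_ x); rewrite inE sum_nat_eq0.
  by move/forallP/(_ y); rewrite inE; case: (g x y).
have k0n : (0 < k <= n)%N by rewrite k0.
have [d [lam [d0 dpos clique indep]]] := S_graph_weights R k0n.
have ylam := S_graph_weights_eigen kn clique indep.
set y := fun i : 'I_n => 1 + d * (i < k)%N%:R in ylam.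
have y0 i : 0 < y i by rewrite ltr_pwDl ?mulr_ge0 ?ler0n.
pose o := Ordinal (leq_trans k0 kn).
have lamS : lam <= qS.
  apply: maxS; apply/eigenvalueP; exists (\row_i y i).
    apply/rowP => j; rewrite mul_signless_laplacian // !mxE -ylam.
    by apply: eq_bigr => i _; rewrite !mxE.
  apply/eqP => /rowP/(_ o); rewrite !mxE => /eqP; rewrite gt_eqF //.
have [x0 [x0_ge0 [i1 x0i1] x0q]] := eigenvalue_le_qform gS eG.
have [f f_anti] := antitone_perm x0.
pose h : rel 'I_n := fun i j => g (f i) (f j); pose x i := x0 (f i).
have hS : simple_graph h by case: gS => gC gI; split=> [i j|i]; [exact: gC|exact: gI].
have hk : k_degenerate k h := k_degenerate_perm gk.
have hq : qG * \sum_i x i ^+ 2 <= qform h x.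
  move: x0q; rewrite /qform (reindex_inj (@perm_inj _ f)) /=.
  rewrite [X in _ <= X](reindex_inj (@perm_inj _ f)) /=.
  by under [X in _ <= X]eq_bigr do rewrite (reindex_inj (@perm_inj _ f)) /=.
have hSx : qform h x <= qform (@S_graph n k) x.
  by apply: qform_le_S_graph => // i; apply: x0_ge0.
have Sx := qform_le x SC y0 ylam.
have lamx : lam * \sum_i x i ^+ 2 <= qG * \sum_i x i ^+ 2.
  rewrite ler_wpM2r ?(le_trans lamS) //.
  by apply: sumr_ge0 => i _; apply: sqr_ge0.
(* The chain [lam |x|^2 <= qG |x|^2 <= qform h x <= qform S x <= lam |x|^2] closes up, so [lra] can
   supply the equalities needed below. *)
have xy := qform_eq SC y0 ylam (x := x).
(* In S_{n,k} the clique vertex [o] is adjacent to all others, so proportionality along its edges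
   determines [x]. *)
have xE i : x i = x o / y o * y i.
  have [-> | io] := eqVneq i o; first by rewrite divfK // gt_eqF.
  rewrite mulrAC (xy _ o i) ?mulfK ?gt_eqF //; first lra.
  by rewrite /S_graph eq_sym io k0.
have c0 : x o / y o != 0.
  apply: contraNneq x0i1 => c0.
  by have := xE (f^-1%g i1); rewrite c0 mul0r /x permKV => ->.
have hE : h =2 @S_graph n k.
  apply: (@qform_eq_S_graph R n k h hS hk d (x o / y o) x) => //; lra.
by apply: niso; exists f^-1%g => i j; rewrite -hE /h !permKV.
Qed.
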